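(* Let $\mathcal P$ be a collection of probability measures on a measurable space $(\Omega,\mathcal F)$, and let $(X_n)_{n=1}^\infty$ be random variables on $(\Omega,\mathcal F)$ that are independent under every $P\in\mathcal P$. For $c>0$ write $X_n^{\le c}:=X_n\,\mathbf 1\{|X_n|\le c\}$. Suppose that for some $c>0$, $$\lim_{m\to\infty}\sup_{P\in\mathcal P}\sum_{n=m}^\infty\left|\mathbb E_PX_n^{\le c}\right|=0,\quad\lim_{m\to\infty}\sup_{P\in\mathcal P}\sum_{n=m}^\infty\mathrm{Var}_P\,X_n^{\le c}=0,\quad\text{and}\quad\lim_{m\to\infty}\sup_{P\in\mathcal P}\sum_{n=m}^\infty P(|X_n|>c)=0.$$ Then $S_n:=\sum_{i=1}^nX_i$ is $\mathcal P$-uniformly Cauchy.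
   Context: $\mathbb E_P$ and $\mathrm{Var}_P$ denote expectation and variance under $P$. A sequence $(Y_n)_{n=1}^\infty$ of random variables is $\mathcal P$-uniformly Cauchy if for every $\varepsilon>0$, $$\lim_{m\to\infty}\sup_{P\in\mathcal P}P\left(\sup_{k,n\ge m}|Y_k-Y_n|\ge\varepsilon\right)=0.$$ *)

(* Defs.v *)
From HB Require Import structures.
From mathcomp Require Import all_boot all_order all_algebra.
From mathcomp Require Import finmap.
From mathcomp Require Import all_classical all_reals all_analysis.

Set Implicit Arguments.
Unset Strict Implicit.
Unset Printing Implicit Defensive.

Import Order.TTheory GRing.Theory Num.Theory.
Import numFieldNormedType.Exports.

Local Open Scope classical_set_scope.
Local Open Scope ring_scope.

(* X w * 1{|X w| <= c} *)
Definition truncate {T : Type} {R : realType} (c : R) (X : T -> R) : T -> R :=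
  fun w => X w * \1_[set w' | `|X w'| <= c] w.

(* Mutual independence under P of the family (X i), i in I: the product rule
   over every finite subfamily and all Borel sets. *)
Definition independent_rvs {d : measure_display} {T : measurableType d}
    {R : realType} (P : probability T R) (I : set nat) (X : nat -> T -> R) :
    Prop :=
  forall (J : {fset nat}) (B : nat -> set R),
    [set` J] `<=` I ->
    (forall i, i \in J -> measurable (B i)) ->
    P (\bigcap_(i in [set` J]) (X i @^-1` B i)) =
      (\prod_(i <- J) P (X i @^-1` B i))%E.

(* Supremum over the family calP of a [0, +oo]-valued quantity. The supremum is
   taken in [0, +oo], so that it is 0 (and not -oo) when calP is empty; adjoining
   0 changes nothing when calP is nonempty. *)
Definition sup_over {d : measure_display} {T : measurableType d} {R : realType}
    (calP : set (probability T R)) (f : probability T R -> \bar R) : \bar R :=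
  ereal_sup (0%E |` (f @` calP)).

(* The inner supremum is taken in \bar R, hence may be +oo at some w. *)
Definition uniformly_cauchy {d : measure_display} {T : measurableType d}
    {R : realType} (calP : set (probability T R)) (Y : nat -> T -> R) : Prop :=
  forall eps : R, 0 < eps ->
    (fun m : nat => sup_over calP (fun P : probability T R =>
       P [set w | (eps%:E <= ereal_sup
            [set `|Y kn.1 w - Y kn.2 w|%:E
               | kn in [set kn : nat * nat | (m <= kn.1)%N /\ (m <= kn.2)%N]])%E]))
      @ \oo --> 0%E.

(* Main.v *)
Require Import Defs.
From HB Require Import structures.
From mathcomp Require Import all_boot all_order all_algebra.
From mathcomp Require Import finmap.
From mathcomp Require Import all_classical all_reals all_analysis.
From mathcomp Require Import measurable_realfun.
From mathcomp Require Import lra.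

Set Implicit Arguments.
Unset Strict Implicit.
Unset Printing Implicit Defensive.

Import Order.TTheory GRing.Theory Num.Theory.
Import numFieldNormedType.Exports.

Local Open Scope classical_set_scope.
Local Open Scope ring_scope.

(** Fix one law P, an index m >= 1 and d > 0, and suppose that the means of the
    truncated variables Y_i from index m on have total absolute value at most d.
    Two exceptional events control the sums of the X_i from m on. Unless some |X_i| with
    i >= m exceeds c, every X_i is equal to Y_i; replacing Y_i by the centred
    variable Z_i = Y_i - E Y_i changes a partial sum by at most d; and, unless
    some partial sum of the Z_i from m reaches d in absolute value, all partial
    sums of the X_i from m stay within 2d, so that any two S_k, S_n with
    k, n >= m differ by at most 4d. The first exceptional event costs the tail
    series, by the union bound. The second costs d^-2 times the series of
    variances, by Kolmogorov's maximal inequality (kolmogorov_max_ineq).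
    The resulting estimate (oscillation_bound) has no constant depending on P,
    so taking suprema over the family and letting m tend to infinity with
    d = e / 8 gives the theorem.

    Kolmogorov's inequality is proved with the walk that stops moving as soon as
    its absolute value reaches e (stopped_walk). Once outside ]-e, e[ it stays
    there, so the maximum of the partial sums has reached e by time k exactly
    when the stopped walk W_k lies outside ]-e, e[, and Chebyshev's inequality
    for the single variable W_k suffices. Its second moment grows at each step
    by at most E Z_k^2, because W_k is a function of the past and is therefore
    independent of the centred variable Z_k, which kills the cross term
    (stopped_walk_moment2). Independence from the past is the passage from
    finite product rules to generated sigma-algebras (indep_past), and the
    product formula for expectations is Fubini's theorem for the joint law
    (expectation_indep_mul). *)

(** * Expectations of bounded variables *)

Lemma Lfun1_bounded (d : measure_display) (T : measurableType d)
    (R : realType) (P : probability T R) (f : T -> R) (b : R) :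
    measurable_fun [set: T] f -> (forall w, `|f w| <= b) ->
  f \in Lfun P 1.
Proof.
move=> mf fb; apply/Lfun1_integrable.
apply: measurable_bounded_integrable => //.
  by rewrite (le_lt_trans (probability_le1 _ _)) ?ltry.
exists b; split; first exact: num_real.
by move=> x bx w _; exact: le_trans (fb w) (ltW bx).
Qed.

(** The product rule on rectangles identifies the law of (U, V) with the product
    of the laws of U and V; Fubini's theorem then computes the integral of x * y.
    Boundedness supplies the integrability hypotheses along the way. *)
Lemma expectation_indep_mul (d : measure_display) (T : measurableType d)
    (R : realType) (P : probability T R) (U V : {mfun T >-> R}) (b : R) :
    (forall w, `|U w| <= b) -> (forall w, `|V w| <= b) ->
    (forall A B : set R, measurable A -> measurable B ->
      P (U @^-1` A `&` V @^-1` B) = (P (U @^-1` A) * P (V @^-1` B))%E) ->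
  ('E_P[fun w => (U w * V w)%R] = 'E_P[U] * 'E_P[V])%E.
Proof.
move=> Ub Vb UV.
have mU : measurable_fun [set: T] U by exact: measurable_funPT.
have mV : measurable_fun [set: T] V by exact: measurable_funPT.
have mUV : measurable_fun [set: T] (fun w => (U w, V w)).
  exact: measurable_fun_pair.
pose UV' : {mfun T >-> (R * R)%type} := mfun_Sub (mem_set mUV).
pose f (z : R * R) : \bar R := (z.1 * z.2)%:E.
have mf : measurable_fun [set: R * R] f.
  apply/measurable_EFinP; apply: measurable_funM;
    [exact: measurable_fst|exact: measurable_snd].
have U1 : (U : T -> R) \in Lfun P 1 by exact: (@Lfun1_bounded _ _ _ _ _ b).
have V1 : (V : T -> R) \in Lfun P 1 by exact: (@Lfun1_bounded _ _ _ _ _ b).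
have UV1 : (fun w => U w * V w) \in Lfun P 1.
  apply: (@Lfun1_bounded _ _ _ _ _ (b * b)); first exact: measurable_funM.
  by move=> w; rewrite normrM ler_pM.
pose muU := distribution P U; pose muV := distribution P V.
have joint X : measurable X -> (muU \x muV)%E X = distribution P UV' X.
  by apply: product_measure_unique => A B mA mB; rewrite -UV.
have fint : (muU \x muV)%E.-integrable [set: R * R] f.
  have : (distribution P UV').-integrable [set: R * R] f.
    apply: integrable_pushforward => //.
    by rewrite preimage_setT; apply/Lfun1_integrable.
  move=> /integrableP[_ fi]; apply/integrableP; split => //.
  by rewrite (eq_measure_integral (distribution P UV')) // => A mA _; exact: joint.
have idU : muU.-integrable [set: R] EFin.
  apply: integrable_pushforward => //.
  by rewrite preimage_setT; apply/Lfun1_integrable.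
have idV : muV.-integrable [set: R] EFin.
  apply: integrable_pushforward => //.
  by rewrite preimage_setT; apply/Lfun1_integrable.
have EU : (\int[muU]_x x%:E)%E = 'E_P[U]%E.
  by rewrite unlock integral_distribution//; apply/Lfun1_integrable.
have EV : (\int[muV]_x x%:E)%E = 'E_P[V]%E.
  by rewrite unlock integral_distribution//; apply/Lfun1_integrable.
have EVfin : 'E_P[V]%E \is a fin_num by exact: expectation_fin_num.
transitivity (\int[distribution P UV']_z f z)%E.
  rewrite integral_distribution//.
  - by rewrite expectation.unlock.
  - exact/Lfun1_integrable.
rewrite -(eq_measure_integral (distribution P UV') (fun A mA _ => joint A mA)).
rewrite -integral12_prod_meas1//.
transitivity (\int[muU]_x (x%:E * 'E_P[V]))%E.
  apply: eq_integral => x _; rewrite /fubini_F -EV -integralZl//.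
rewrite -EU -(fineK EVfin) integralZr//.
Qed.

(** * Independence from the past *)

(** A generating family of the sigma-algebra of (Z_i), i in J, chosen because it
    is closed under intersection and because the product rule applies to each of
    its members. *)
Definition cylinders (T : Type) (R : realType) (J : {fset nat})
    (Z : nat -> T -> R) : set (set T) :=
  [set C | exists2 B : nat -> set R, (forall i, measurable (B i)) &
     C = \bigcap_(i in [set` J]) (Z i @^-1` B i)].

Lemma cylinders_measurable (d : measure_display) (T : measurableType d)
    (R : realType) (J : {fset nat}) (Z : nat -> T -> R) :
    (forall i, measurable_fun [set: T] (Z i)) ->
  cylinders J Z `<=` measurable.
Proof.
move=> mZ _ [B mB ->]; apply: fin_bigcap_measurable => // i _.
by rewrite -[X in measurable X]setTI; exact: mZ.
Qed.

(** For fixed B, both sides are finite measures in C: the restriction of P to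
    the event Z_j in B, and P scaled by the probability of that event. They agree
    on cylinders, by the product rule over j |` J, hence on the generated
    sigma-algebra, by uniqueness of measures on a pi-system. *)
Lemma indep_past (d : measure_display) (T : measurableType d)
    (R : realType) (P : probability T R) (I : set nat) (Z : nat -> T -> R)
    (J : {fset nat}) (j : nat) (C : set T) (B : set R) :
    (forall i, measurable_fun [set: T] (Z i)) ->
    independent_rvs P I Z -> [set` J] `<=` I -> I j -> j \notin J ->
    <<s cylinders J Z >> C -> measurable B ->
  P (C `&` Z j @^-1` B) = (P C * P (Z j @^-1` B))%E.
Proof.
move=> mZ indZ JI Ij jJ sC mB.
have mZB : measurable (Z j @^-1` B).
  by rewrite -[X in measurable X]setTI; exact: mZ.
pose m1 := mrestr P mZB.
have r0 : (0 <= fine (P (Z j @^-1` B)))%R by rewrite fine_ge0.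
pose m2 := mscale (NngNum r0) P.
have ZBfin : P (Z j @^-1` B) \is a fin_num by exact: fin_num_measure.
suff -> : P (C `&` Z j @^-1` B) = m2 C.
  by rewrite /m2/= /mscale/= fineK// muleC.
change (m1 C = m2 C).
apply: (@g_sigma_algebra_measure_unique _ _ _ (cylinders J Z) _
  (fun=> setT) _ _ m1 m2) => //.
- exact: cylinders_measurable.
- move=> _; exists (fun=> setT) => //.
  by apply/esym; rewrite -subTset => w _ i _.
- by rewrite bigcup_const//; exists 0%N.
- move=> _ _ [A mA ->] [A' mA' ->]; exists (fun i => A i `&` A' i).
    by move=> i; exact: measurableI.
  by rewrite -bigcapI.
- move=> _ [A mA ->].
  rewrite /m1/= /mrestr/= /m2/= /mscale/= fineK//.
  (* The constraint on Z j is merged into the cylinder, j being outside J. *)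
  pose A' i := if i == j then B else A i.
  have mA' i : measurable (A' i) by rewrite /A'; case: ifP.
  have AJ i : i \in J -> A' i = A i.
    by move=> iJ; rewrite /A'; case: eqP => // ij; rewrite -ij iJ in jJ.
  have -> : \bigcap_(i in [set` J]) (Z i @^-1` A i) `&` Z j @^-1` B =
      \bigcap_(i in [set` (j |` J)%fset]) (Z i @^-1` A' i).
    rewrite set_fsetU1 bigcap_setU1 setIC {1}/A' eqxx; congr setI.
    by apply: eq_bigcapr => i /= iJ; rewrite AJ.
  rewrite indZ//; last first.
    by rewrite set_fsetU1 => i /= [->//|]; exact: JI.
  rewrite big_fsetU1//= {1}/A' eqxx; congr mule; rewrite indZ//.
  by rewrite [RHS]big_seq [LHS]big_seq; apply: eq_bigr => i /AJ ->.
- by rewrite /m1/= /mrestr/= setTI ltey_eq ZBfin.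
Qed.

(** * Kolmogorov's maximal inequality *)

Definition stop_step (R : realType) (e x z : R) : R :=
  if `|x| < e then x + z else x.

(** The partial sums of Z_m, Z_(m+1), and so on, frozen at the first one whose
    absolute value is at least e; k counts the steps taken. *)
Fixpoint stopped_walk (T : Type) (R : realType) (e : R) (Z : nat -> T -> R)
    (m k : nat) (w : T) : R :=
  if k is k'.+1 then stop_step e (stopped_walk e Z m k' w) (Z (m + k')%N w)
  else 0.

(** Being inside ]-e, e[ at time k means that the walk was never stopped. *)
Lemma stopped_walk_lt (T : Type) (R : realType) (e : R) (Z : nat -> T -> R)
    (m k : nat) (w : T) :
    `|stopped_walk e Z m k w| < e ->
  stopped_walk e Z m k w = \sum_(m <= i < m + k) Z i w.
Proof.
elim: k => [|k IH] /=; first by rewrite addn0 big_geq.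
rewrite /stop_step; case: ifPn => [lt_e _|/negP//].
by rewrite IH// addnS big_nat_recr//= leq_addr.
Qed.

Lemma stopped_walkS_lt (T : Type) (R : realType) (e : R) (Z : nat -> T -> R)
    (m k : nat) (w : T) :
  `|stopped_walk e Z m k.+1 w| < e -> `|stopped_walk e Z m k w| < e.
Proof. by rewrite /= /stop_step; case: ifPn => // /negP. Qed.

(** The last step taken starts inside ]-e, e[ and has size at most b. *)
Lemma stopped_walk_bounded (T : Type) (R : realType) (e b : R)
    (Z : nat -> T -> R) (m k : nat) (w : T) :
    0 <= e -> 0 <= b -> (forall i w, `|Z i w| <= b) ->
  `|stopped_walk e Z m k w| <= e + b.
Proof.
move=> e0 b0 Zb; elim: k => [|k IH] /=; first by rewrite normr0 addr_ge0.
rewrite /stop_step; case: ifP => // lt_e.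
by rewrite (le_trans (ler_normD _ _))// lerD// ltW.
Qed.

(** Measurability is required only of the increments used, so that the lemma also
    applies to T equipped with the sigma-algebra of the past. *)
Lemma measurable_stopped_walk (d : measure_display) (T : measurableType d)
    (R : realType) (e : R) (Z : nat -> T -> R) (m k : nat) :
    (forall i, (m <= i < m + k)%N -> measurable_fun [set: T] (Z i)) ->
  measurable_fun [set: T] (stopped_walk e Z m k).
Proof.
elim: k => [|k IH] mZ; first exact: measurable_cst.
have mW : measurable_fun [set: T] (stopped_walk e Z m k).
  by apply: IH => i /andP[mi ik]; apply: mZ; rewrite mi addnS ltnS ltnW.
rewrite [X in measurable_fun _ X](_ : _ =
  (fun w => if `|stopped_walk e Z m k w| < e
            then stopped_walk e Z m k w + Z (m + k)%N w
            else stopped_walk e Z m k w))//.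
apply: measurable_fun_ifT => //.
- by apply: measurable_fun_ltr => //; exact: measurableT_comp.
- by apply: measurable_funD => //; apply: mZ; rewrite leq_addr addnS leqnn.
Qed.

Lemma measurable_coordinate (d : measure_display) (T : measurableType d)
    (R : realType) (J : {fset nat}) (Z : nat -> T -> R) (i : nat) :
    i \in J ->
  measurable_fun [set: g_sigma_algebraType (cylinders J Z)]
    (Z i : g_sigma_algebraType (cylinders J Z) -> R).
Proof.
move=> iJ _ B mB; rewrite setTI; apply: sub_sigma_algebra.
exists (fun j => if j == i then B else setT).
  by move=> j; case: ifP.
apply/seteqP; split => [w Bw j /= _|w /(_ i iJ)]; last by rewrite /= eqxx.
by case: eqP => // ->.
Qed.

(** W_k is built from Z_i with m <= i < m + k, so it is measurable for the
    sigma-algebra generated by them. *)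
Lemma stopped_walk_indep (d : measure_display) (T : measurableType d)
    (R : realType) (P : probability T R) (Z : nat -> T -> R) (e : R)
    (m k : nat) (A B : set R) :
    (forall i, measurable_fun [set: T] (Z i)) ->
    independent_rvs P [set n | (m <= n)%N] Z ->
    measurable A -> measurable B ->
  P (stopped_walk e Z m k @^-1` A `&` Z (m + k)%N @^-1` B) =
  (P (stopped_walk e Z m k @^-1` A) * P (Z (m + k)%N @^-1` B))%E.
Proof.
move=> mZ indZ mA mB; pose J := [fset i in iota m k]%fset.
have inJ i : (i \in J) = (m <= i < m + k)%N by rewrite inE/= mem_iota.
apply: (@indep_past _ _ _ _ [set n | (m <= n)%N] _ J) => //.
- by move=> i /=; rewrite inJ => /andP[].
- by rewrite /= leq_addr.
- by rewrite inJ ltnn andbF.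
- have : measurable_fun [set: g_sigma_algebraType (cylinders J Z)]
     (stopped_walk e Z m k : g_sigma_algebraType (cylinders J Z) -> R).
    apply: measurable_stopped_walk => i; rewrite -inJ; exact: measurable_coordinate.
  by move=> /(_ measurableT _ mA); rewrite setTI.
Qed.

(** Let U be W_k when |W_k| < e and 0 otherwise. A step adds to W_k^2 at most
    2 U Z + Z^2 with Z the next increment, and E[U Z] = E[U] E[Z] = 0. *)
Lemma stopped_walk_moment2 (d : measure_display) (T : measurableType d)
    (R : realType) (P : probability T R) (Z : nat -> T -> R) (e b : R)
    (m k : nat) :
    0 <= e -> 0 <= b ->
    (forall i, measurable_fun [set: T] (Z i)) -> (forall i w, `|Z i w| <= b) ->
    (forall i, 'E_P[Z i] = 0)%E ->
    independent_rvs P [set n | (m <= n)%N] Z ->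
  ('E_P[fun w => (stopped_walk e Z m k w ^+ 2)%R] <=
   \sum_(m <= i < m + k) 'E_P[fun w => (Z i w ^+ 2)%R])%E.
Proof.
move=> e0 b0 mZ Zb EZ0 indZ; elim: k => [|k IH].
  rewrite addn0 big_geq// expectation.unlock.
  by under eq_integral do rewrite /= expr0n/=; rewrite integral0.
rewrite addnS big_nat_recr/= ?leq_addr//; apply: le_trans (leeD2r _ IH).
set W := stopped_walk e Z m k; set z := Z (m + k)%N.
have mW : measurable_fun [set: T] W by exact: measurable_stopped_walk.
have mz : measurable_fun [set: T] z by exact: mZ.
pose cut (x : R) := if `|x| < e then x else 0.
have mcut : measurable_fun [set: R] cut.
  apply: measurable_fun_ifT; [|exact: measurable_id|exact: measurable_cst].
  by apply: measurable_fun_ltr => //; exact: normr_measurable.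
have mU : measurable_fun [set: T] (cut \o W) by exact: measurableT_comp.
pose U : {mfun T >-> R} := mfun_Sub (mem_set mU).
pose V : {mfun T >-> R} := mfun_Sub (mem_set (mZ (m + k)%N)).
have Ub w : `|U w| <= e + b.
  rewrite /U/= /cut; case: ifPn => [/ltW le_e|_].
    by rewrite (le_trans le_e)// lerDl.
  by rewrite normr0 addr_ge0.
have Vb w : `|V w| <= e + b by rewrite (le_trans (Zb _ _))// lerDr.
have EUV : 'E_P[fun w => (U w * V w)%R]%E = 0%E.
  rewrite (expectation_indep_mul Ub Vb); first by rewrite (EZ0 (m + k)%N) mule0.
  move=> A B mA mB; rewrite /U/= comp_preimage.
  apply: stopped_walk_indep => //.
  by rewrite -[X in measurable X]setTI; exact: mcut.
have W2 : (fun w => W w ^+ 2) \in Lfun P 1.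
  apply: (@Lfun1_bounded _ _ _ _ _ ((e + b) ^+ 2)).
    exact: measurable_funX.
  by move=> w; rewrite normrX lerXn2r ?nnegrE ?addr_ge0// stopped_walk_bounded.
have z2 : (fun w => z w ^+ 2) \in Lfun P 1.
  apply: (@Lfun1_bounded _ _ _ _ _ (b ^+ 2)); first exact: measurable_funX.
  by move=> w; rewrite normrX lerXn2r ?nnegrE//; exact: Zb.
have UV1 : (fun w => U w * V w) \in Lfun P 1.
  apply: (@Lfun1_bounded _ _ _ _ _ ((e + b) * (e + b))).
    exact: measurable_funM.
  by move=> w; rewrite normrM ler_pM.
have UV2 : 2 \o* (fun w => U w * V w) \in Lfun P 1 by exact: Lfun_scale.
have WU : ((fun w => W w ^+ 2) \+ 2 \o* (fun w => U w * V w)) \in Lfun P 1.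
  exact: rpredD.
have -> : ('E_P[fun w => (W w ^+ 2)%R] + 'E_P[fun w => (z w ^+ 2)%R] =
    'E_P[(((fun w => W w ^+ 2) \+ 2 \o* (fun w => U w * V w)) \+
       (fun w => z w ^+ 2))%R])%E.
  rewrite expectationD// expectationD//.
  by rewrite (expectationZl 2 UV1) EUV mule0 adde0.
have step w : stop_step e (W w) (z w) ^+ 2 <=
    W w ^+ 2 + U w * V w * 2 + z w ^+ 2.
  rewrite /U/= /cut /stop_step /V/=; case: ifPn => _.
    by rewrite sqrrD -mulr_natr.
  by rewrite !mul0r addr0 lerDl sqr_ge0.
have mS : measurable_fun [set: T] (fun w => stop_step e (W w) (z w)).
  exact: (@measurable_stopped_walk _ _ _ e Z m k.+1).
apply: expectation_le.
- exact: measurable_funX.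
- apply: measurable_funD; last exact: measurable_funX.
  apply: measurable_funD; first exact: measurable_funX.
  by apply: measurable_funM => //; exact: measurable_funM.
- by move=> w; exact: sqr_ge0.
- by move=> w; apply: le_trans (step w); exact: sqr_ge0.
- exact/aeW.
Qed.

(** The events |W_k| >= e increase with k and their union is the event that some
    partial sum reaches e, so it is enough to bound each of them with
    Chebyshev's inequality. *)
Lemma kolmogorov_max_ineq (d : measure_display) (T : measurableType d)
    (R : realType) (P : probability T R) (Z : nat -> T -> R) (e b : R)
    (m : nat) :
    0 < e -> 0 <= b ->
    (forall i, measurable_fun [set: T] (Z i)) -> (forall i w, `|Z i w| <= b) ->
    (forall i, 'E_P[Z i] = 0)%E ->
    independent_rvs P [set n | (m <= n)%N] Z ->
  (P [set w | exists k, (e <= `|\sum_(m <= i < m + k) Z i w|)%R] <=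
   (e ^- 2)%:E * \sum_(m <= i <oo) 'E_P[fun w => (Z i w ^+ 2)%R])%E.
Proof.
move=> e0 b0 mZ Zb EZ0 indZ.
pose A k := [set w | e <= `|stopped_walk e Z m k w|].
have mW k : measurable_fun [set: T] (stopped_walk e Z m k).
  exact: measurable_stopped_walk.
have mA k : measurable (A k).
  rewrite [X in measurable X](_ : _ =
      [set: T] `&` [set w | e <= `|stopped_walk e Z m k w|]); last first.
    by rewrite setTI.
  by apply: measurable_fun_le => //; exact: measurableT_comp.
have -> : [set w | exists k, e <= `|\sum_(m <= i < m + k) Z i w|] =
    \bigcup_k A k.
  apply/seteqP; split => w /=.
    move=> [k ek]; exists k => //; rewrite /A/= leNgt; apply/negP => lt_e.
    by move: ek; rewrite -(stopped_walk_lt lt_e) leNgt lt_e.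
  move=> [k _]; elim: k => [|k IH] /=; rewrite /A/=.
    by rewrite normr0 leNgt e0.
  case: (leP e `|stopped_walk e Z m k w|) => [/IH//|lt_e].
  rewrite /stop_step lt_e => le_e; exists k.+1.
  by rewrite addnS big_nat_recr ?leq_addr//= -(stopped_walk_lt lt_e).
have ndA : nondecreasing_seq A.
  apply/nondecreasing_seqP => k; apply/subsetPset => w; rewrite /A/= !leNgt.
  by apply: contraNN; exact: stopped_walkS_lt.
have cvA := @nondecreasing_cvg_mu _ _ _ P _ mA
  (bigcup_measurable (fun k _ => mA k)) ndA.
apply: (cvge_le _ cvA).
apply: nearW => k /=.
pose W : {mfun T >-> R} := mfun_Sub (mem_set (mW k)).
have cheb : ((e ^+ 2)%:E * P (A k) <= 'E_P[fun w => (W w ^+ 2)%R])%E.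
  rewrite [X in (_ <= 'E_P[X])%E](_ : _ =
      (fun x : R => x ^+ 2) \o (fun x => `|x|) \o W); last first.
    by apply/funext => w /=; rewrite real_normK// num_real.
  apply: markov => //.
  - by move=> x _; exact: sqr_ge0.
  - by move=> x y; rewrite !nnegrE => x0 y0 xy; rewrite lerXn2r.
rewrite -lee_pdivlMl ?exprn_gt0// in cheb.
apply: (le_trans cheb); apply: lee_wpmul2l.
  by rewrite lee_fin invr_ge0 exprn_ge0// ltW.
apply: le_trans (stopped_walk_moment2 k (ltW e0) b0 mZ Zb EZ0 indZ) _.
apply: nneseries_lim_ge => n _ _; apply: expectation_ge0 => w.
exact: sqr_ge0.
Qed.

(** * Truncation, oscillation events and tail series *)

Lemma independent_rvs_comp (d : measure_display) (T : measurableType d)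
    (R : realType) (P : probability T R) (I I' : set nat)
    (X : nat -> T -> R) (h : nat -> R -> R) :
    I' `<=` I -> (forall i, measurable_fun [set: R] (h i)) ->
    independent_rvs P I X ->
  independent_rvs P I' (fun i => h i \o X i).
Proof.
move=> I'I mh indX J B JI mB.
apply: (indX J (fun i => h i @^-1` B i)) => [i /JI/I'I//|i iJ].
by rewrite -[X in measurable X]setTI; apply: mh => //; exact: mB.
Qed.

Lemma truncate_id (T : Type) (R : realType) (c : R) (X : T -> R) (w : T) :
  `|X w| <= c -> truncate c X w = X w.
Proof. by move=> Xc; rewrite /truncate indicE mem_set ?mulr1. Qed.

Lemma truncate_bounded (T : Type) (R : realType) (c : R) (X : T -> R) (w : T) :
  0 <= c -> `|truncate c X w| <= c.
Proof.
move=> c0; rewrite /truncate indicE; case: (boolP (w \in _)) => [|_].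
  rewrite inE/= => Xc.
  by rewrite mulr1.
by rewrite mulr0 normr0.
Qed.

Lemma measurable_truncate (d : measure_display) (T : measurableType d)
    (R : realType) (c : R) (X : T -> R) :
  measurable_fun [set: T] X -> measurable_fun [set: T] (truncate c X).
Proof.
move=> mX; apply: measurable_funM => //; apply: measurable_indic.
rewrite -[X in measurable X]setTI; apply: measurable_fun_le => //.
exact: measurableT_comp.
Qed.

Lemma fine_expectation_bounded (d : measure_display) (T : measurableType d)
    (R : realType) (P : probability T R) (f : T -> R) (b : R) :
    measurable_fun [set: T] f -> (forall w, `|f w| <= b) ->
  `|fine 'E_P[f]%E| <= b.
Proof.
move=> mf fb; have f1 := Lfun1_bounded P mf fb.
rewrite -lee_fin -abse_EFin fineK ?expectation_fin_num// expectation.unlock.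
have mEf : measurable_fun [set: T] (EFin \o f) by exact/measurable_EFinP.
apply: le_trans (le_abse_integral _ _ _) _ => //.
apply: le_trans (integral_le_bound b%:E _ _ _ _) _ => //.
- by rewrite lee_fin; exact: le_trans (fb point).
- by apply/aeW => w _ /=; rewrite lee_fin.
- by rewrite [X in (_ * X)%E](probability_setT P) mule1.
Qed.

(** The supremum of a countable family is at least e exactly when, for every j,
    some member exceeds e - 1 / (j + 1). *)
Lemma measurable_oscillation (d : measure_display) (T : measurableType d)
    (R : realType) (Y : nat -> T -> R) (m : nat) (e : R) :
    (forall i, measurable_fun [set: T] (Y i)) ->
  measurable [set w | (e%:E <= ereal_sup
    [set `|Y kn.1 w - Y kn.2 w|%:E
      | kn in [set kn : nat * nat | (m <= kn.1)%N /\ (m <= kn.2)%N]])%E].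
Proof.
move=> mY.
rewrite [X in measurable X](_ : _ = \bigcap_j \bigcup_(k in [set k | (m <= k)%N])
    \bigcup_(n in [set n | (m <= n)%N])
    [set w | e - j.+1%:R^-1 < `|Y k w - Y n w|]).
  apply: bigcap_measurable => // j _.
  apply: bigcup_measurable => k _; apply: bigcup_measurable => n _.
  rewrite -[X in measurable X]setTI.
  apply: (measurable_fun_ltr _ _ measurableT (Y := [set true])) => //.
  by apply: measurableT_comp => //; exact: measurable_funB.
apply/seteqP; split => w /=.
  move=> le_sup j _; have : ((e - j.+1%:R^-1)%:E < ereal_sup
      [set `|Y kn.1 w - Y kn.2 w|%:E
        | kn in [set kn : nat * nat | (m <= kn.1)%N /\ (m <= kn.2)%N]])%E.
    by apply: lt_le_trans le_sup; rewrite lte_fin ltrBlDr ltrDl invr_gt0.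
  move=> /ereal_sup_gt[_ [[k n] /= [mk mn] <-]]; rewrite lte_fin => lt_osc.
  by exists k => //; exists n.
move=> osc; apply/lee_subgt0Pr => r r0.
have [j jr] : exists j : nat, j.+1%:R^-1 < r.
  exists (Num.truncn r^-1); rewrite -[ltRHS]invrK ltf_pV2 ?posrE ?invr_gt0//.
  by rewrite truncnS_gt.
have [k mk [n mn lt_osc]] := osc j I.
apply: le_ereal_sup_tmp; exists `|Y k w - Y n w|%:E; first by exists (k, n).
by rewrite -EFinB lee_fin ltW// (lt_trans _ lt_osc)// ltrD2l ltrN2.
Qed.

Lemma le_measure_bigcup_from (d : measure_display) (T : measurableType d)
    (R : realType) (P : probability T R) (B : nat -> set T) (m : nat) :
    (forall i, measurable (B i)) ->
  (P (\bigcup_(i in [set i | (m <= i)%N]) B i) <= \sum_(m <= i <oo) P (B i))%E.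
Proof.
move=> mB; rewrite -nneseries_addn//.
rewrite [X in P X](_ : _ = \bigcup_i B (i + m)%N).
  by apply: generalized_Boole_inequality => //; exact: bigcup_measurable.
apply/seteqP; split => w [i /= mi Bi].
  by exists (i - m)%N => //; rewrite subnK.
by exists (i + m)%N => //=; exact: leq_addl.
Qed.

(** * The uniform bound and its limit *)

(** The estimate for a single law: outside the events that some |X_i| exceeds c
    and that some partial sum of the centred truncations reaches dlt, two partial
    sums differ by at most four times dlt, one dlt for the centred part and one
    for the means in each of the two sums. *)
Lemma oscillation_bound (d : measure_display) (T : measurableType d)
    (R : realType) (P : probability T R) (X : nat -> {mfun T >-> R})
    (c e dlt : R) (m : nat) :
    independent_rvs P [set n : nat | (1 <= n)%N] (fun n => X n : T -> R) ->
    0 <= c -> 0 < dlt -> 4 * dlt < e -> (1 <= m)%N ->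
    (\sum_(m <= n <oo) `| 'E_P[truncate c (X n)] | <= dlt%:E)%E ->
  (P [set w | (e%:E <= ereal_sup
      [set `|(\sum_(1 <= i < kn.1.+1) X i w)%R -
             (\sum_(1 <= i < kn.2.+1) X i w)%R|%R%:E
        | kn in [set kn : nat * nat | (m <= kn.1)%N /\ (m <= kn.2)%N]])%E] <=
   (dlt ^- 2)%:E * (\sum_(m <= n <oo) 'V_P[truncate c (X n)]) +
   \sum_(m <= n <oo) P [set w | (c < `|X n w|)%R])%E.
Proof.
move=> indX c0 dlt0 dlte m1 mean_le.
have mX i : measurable_fun [set: T] (X i) by exact: measurable_funPT.
pose Y i := truncate c (X i).
have mY i : measurable_fun [set: T] (Y i) by exact: measurable_truncate.
have Yc i w : `|Y i w| <= c by exact: truncate_bounded.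
have Y1 i : Y i \in Lfun P 1 := Lfun1_bounded P (mY i) (Yc i).
pose a i := fine 'E_P[Y i]%E.
have EY i : 'E_P[Y i]%E = (a i)%:E by rewrite fineK// expectation_fin_num.
have ac i : `|a i| <= c by exact: fine_expectation_bounded.
pose Z i := Y i \- cst (a i).
have mZ i : measurable_fun [set: T] (Z i).
  by apply: measurable_funB => //; exact: measurable_cst.
have Zc i w : `|Z i w| <= c + c.
  exact: le_trans (ler_normB _ _) (lerD (Yc i w) (ac i)).
have EZ i : 'E_P[Z i]%E = 0%E.
  rewrite expectationB// ?expectation_cst ?EY ?subee//.
  exact: Lfun_cst.
have VZ i : 'E_P[fun w => (Z i w ^+ 2)%R]%E = 'V_P[Y i]%E.
  by rewrite /variance covariance.unlock; congr expectation; apply/funext => w.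
have indZ : independent_rvs P [set n | (m <= n)%N] Z.
  (* Z i is the Borel function h i of X i. *)
  pose h i x : R := truncate c id x - a i.
  apply: (independent_rvs_comp (h := h) _ _ indX).
    by move=> n /=; exact: leq_trans.
  move=> i; apply: measurable_funB; last exact: measurable_cst.
  exact: measurable_truncate.
pose A := [set w | exists k, (dlt <= `|\sum_(m <= i < m + k) Z i w|)%R].
pose B i := [set w | c < `|X i w|].
have mB i : measurable (B i).
  rewrite -[B i]setTI.
  apply: (measurable_fun_ltr _ _ measurableT (Y := [set true])) => //.
  exact: measurableT_comp.
have mA : measurable A.
  rewrite [A](_ : _ = \bigcup_k [set w | dlt <= `|\sum_(m <= i < m + k) Z i w|]);
    last by apply/seteqP; split => w [k]; exists k.
  apply: bigcup_measurable => k _; rewrite -[X in measurable X]setTI.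
  apply: measurable_fun_le => //; apply: measurableT_comp => //.
  exact: measurable_sum.
have mBm : measurable (\bigcup_(i in [set i | (m <= i)%N]) B i).
  exact: bigcup_measurable.
apply: (@le_trans _ _ (P (A `|` \bigcup_(i in [set i | (m <= i)%N]) B i))).
  apply: le_measure; rewrite ?inE.
  - apply: (measurable_oscillation (Y := fun n w => \sum_(1 <= i < n.+1) X i w)).
    by move=> i; exact: measurable_sum.
  - exact: measurableU.
  move=> w /=; apply: contraPP => /not_orP[nA nB] /=; apply/negP; rewrite -ltNge.
  have XY i : (m <= i)%N -> X i w = Z i w + a i.
    move=> mi; rewrite /Z /Y/= truncate_id ?subrK//.
    by rewrite leNgt; apply/negP => ci; apply: nB; exists i.
  have sum_a k : `|\sum_(m <= i < m + k) a i| <= dlt.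
    apply: le_trans (ler_norm_sum _ _ _) _; rewrite -lee_fin -sumEFin.
    apply: le_trans mean_le; under [leRHS]eq_eseriesr do rewrite EY abse_EFin.
    exact: nneseries_lim_ge.
  have sum_X k : `|\sum_(m <= i < m + k) X i w| <= dlt + dlt.
    rewrite (eq_big_nat _ _ (F2 := fun i => Z i w + a i)); last first.
      by move=> i /andP[mi _]; exact: XY.
    rewrite big_split/= (le_trans (ler_normD _ _))// lerD// leNgt.
    by apply/negP => lt_Z; apply: nA; exists k; exact: ltW.
  (* Both sums share the terms of index below m, which cancel. *)
  have S_X k : (m <= k)%N -> \sum_(1 <= i < k.+1) X i w =
      \sum_(1 <= i < m) X i w + \sum_(m <= i < m + (k.+1 - m)) X i w.
    by move=> mk; rewrite subnKC 1?leqW// -big_cat_nat//= leqW.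
  apply: (@le_lt_trans _ _ (4 * dlt)%:E); last by rewrite lte_fin.
  apply: ge_ereal_sup => _ [[k n] /= [mk mn] <-]; rewrite lee_fin.
  rewrite (S_X k mk) (S_X n mn) opprD addrACA subrr add0r.
  rewrite (le_trans (ler_normB _ _))//.
  apply: le_trans (lerD (sum_X _) (sum_X _)) _.
  lra.
apply: le_trans (measureU2 _ mA mBm) _; apply: leeD; last first.
  exact: le_measure_bigcup_from.
have := kolmogorov_max_ineq dlt0 (addr_ge0 c0 c0) mZ Zc EZ indZ.
by under eq_eseriesr do rewrite VZ.
Qed.

Lemma sup_over_ge (d : measure_display) (T : measurableType d) (R : realType)
    (calP : set (probability T R)) (f : probability T R -> \bar R) P :
  calP P -> (f P <= sup_over calP f)%E.
Proof. by move=> PP; apply: ereal_sup_ubound; right; exists P. Qed.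

Lemma sup_over_ge0 (d : measure_display) (T : measurableType d) (R : realType)
    (calP : set (probability T R)) (f : probability T R -> \bar R) :
  (0 <= sup_over calP f)%E.
Proof. by apply: ereal_sup_ubound; left. Qed.

(* The sequence is indexed from 1; X 0 plays no role. *)
Theorem theorem4 (d : measure_display) (T : measurableType d) (R : realType)
    (calP : set (probability T R)) (X : nat -> {mfun T >-> R})
    (indep : forall P : probability T R, calP P ->
       independent_rvs P [set n : nat | (1 <= n)%N] (fun n => X n : T -> R))
    (c : R) (c_gt0 : 0 < c)
    (mean0 : (fun m : nat => sup_over calP (fun P : probability T R =>
       (\sum_(m <= n <oo) `| 'E_P[truncate c (X n)] |)%E)) @ \oo --> 0%E)
    (var0 : (fun m : nat => sup_over calP (fun P : probability T R =>
       (\sum_(m <= n <oo) 'V_P[truncate c (X n)])%E)) @ \oo --> 0%E)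
    (tail0 : (fun m : nat => sup_over calP (fun P : probability T R =>
       (\sum_(m <= n <oo) P [set w | (c < `|X n w|)%R])%E)) @ \oo --> 0%E) :
  uniformly_cauchy calP (fun (n : nat) (w : T) => \sum_(1 <= i < n.+1) X i w).
Proof.
(* Any dlt below e / 4 would do; the inequality is strict because the event to be
   bounded contains the points whose oscillation is exactly e. *)
move=> e e0; pose dlt := e / 8.
have dlt0 : 0 < dlt by rewrite divr_gt0.
have dlte : 4 * dlt < e by rewrite /dlt; lra.
have var_cvg := cvgeZl (_ : (dlt ^- 2)%:E \is a fin_num) var0.
have := cvgeD _ (var_cvg isT) tail0; rewrite mule0 adde0 => /(_ _ isT) bound0.
apply: (squeeze_cvge _ (cvg_cst 0%E) bound0).
have mean_small : \forall m \near \oo, (sup_over calP (fun P : probability T R =>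
    \sum_(m <= n <oo) `| 'E_P[truncate c (X n)] |) < dlt%:E)%E.
  apply: (mean0 [set y | (y < dlt%:E)%E]).
  by apply: open_ereal_lt'; rewrite lte_fin.
near=> m; rewrite sup_over_ge0/=; apply: ge_ereal_sup => _ [->|[P PP <-]].
  rewrite adde_ge0// ?sup_over_ge0// mule_ge0 ?sup_over_ge0//.
  by rewrite lee_fin invr_ge0 exprn_ge0// ltW.
have m_gt0 : (1 <= m)%N by near: m; exact: nbhs_infty_ge.
have mean_le : (\sum_(m <= n <oo) `| 'E_P[truncate c (X n)] | <= dlt%:E)%E.
  apply: ltW; apply: (@le_lt_trans _ _ (sup_over calP (fun P : probability T R =>
    \sum_(m <= n <oo) `| 'E_P[truncate c (X n)] |)%E)); last by near: m.
  exact: (sup_over_ge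
    (fun P : probability T R => \sum_(m <= n <oo) `| 'E_P[truncate c (X n)] |)%E).
apply: le_trans
  (oscillation_bound (indep P PP) (ltW c_gt0) dlt0 dlte m_gt0 mean_le) _.
apply: leeD.
  apply: lee_wpmul2l; first by rewrite lee_fin invr_ge0 exprn_ge0// ltW.
  exact: (sup_over_ge
    (fun P : probability T R => \sum_(m <= n <oo) 'V_P[truncate c (X n)])%E).
exact: (sup_over_ge
  (fun P : probability T R => \sum_(m <= n <oo) P [set w | (c < `|X n w|)%R])%E).
Unshelve. all: by end_near.
Qed.
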